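(* If $S$ is a right simple semigroup, then the semigroup $(S,\Lambda;\circ_P)$ is also right simple for any non-empty set $\Lambda$ and any mapping $P:\Lambda\to S$.
   Context: For a semigroup $S$, a non-empty set $\Lambda$ and a mapping $P:\Lambda\to S$, $(S,\Lambda;\circ_P)$ denotes the semigroup with underlying set $S\times\Lambda$ and operation $(s,\lambda)\circ_P(t,\mu)=(s\,P(\lambda)\,t,\ \mu)$. A semigroup $T$ is right simple if it has no proper right ideals, equivalently $aT=T$ for every $a\in T$. *)

(* Defs.v *)
From HB Require Import structures.
From mathcomp Require Import all_boot.
From mathcomp Require Import boolp classical_sets.

Set Implicit Arguments.
Unset Strict Implicit.
Unset Printing Implicit Defensive.

Local Open Scope classical_set_scope.
Local Open Scope group_scope.

Definition right_ideal (T : semigroupType) (R : set T) : Prop :=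
  R !=set0 /\ (forall a x : T, R a -> R (a * x)).

Definition right_simple (T : semigroupType) : Prop :=
  ~ exists R : set T, right_ideal R /\ R <> [set: T].

(* The semigroup (S, Lambda; o_P). Its carrier is an alias of S * Lambda
   indexed by P, so that it does not inherit the componentwise product. *)
Definition sandwich (S : semigroupType) (Lambda : Type) (P : Lambda -> S) :
  Type := (S * Lambda)%type.

Section Sandwich.
Variables (S : semigroupType) (Lambda : Type) (P : Lambda -> S).

Definition sandwich_mul (x y : sandwich P) : sandwich P :=
  (x.1 * P x.2 * y.1, y.2).

Lemma sandwich_mulA : associative sandwich_mul.
Proof. by move=> x y z; rewrite /sandwich_mul /= !mulgA. Qed.

(* semigroupType requires a choice structure; the classical one is available
   for every type, so no structure is imposed on Lambda. *)
HB.instance Definition _ := gen_eqMixin (sandwich P).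
HB.instance Definition _ := gen_choiceMixin (sandwich P).
HB.instance Definition _ := isSemigroup.Build (sandwich P) sandwich_mulA.

End Sandwich.

(* Main.v *)
Require Import Defs.
From mathcomp Require Import all_boot.
From mathcomp Require Import boolp classical_sets.

(** Right simplicity is the solvability of every equation [a * x = b]
    ([right_simpleP]). In the sandwich semigroup the equation
    [(s, l) * (t, m) = (u, n)] is solved by [m = n] and any [t] with
    [(s * P l) * t = u], which is an equation in [S]: the sandwich factor
    [P l] is absorbed into the left coefficient. *)

Local Open Scope group_scope.

(** The set [aT] is a right ideal, hence all of [T] when [T] is right simple;
    conversely a right ideal containing [a] contains [aT]. *)
Lemma right_simpleP (T : semigroupType) :
  right_simple T <-> forall a b : T, exists x, a * x = b.
Proof.
split=> [simT a b | solT [R [[[a Ra] RM] /eqP]]].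
- apply: contrapT => nsol; apply: simT.
  exists (range (fun x : T => a * x)); split; last first.
    move=> aTE; have : range (fun x : T => a * x) b by rewrite aTE.
    by move=> [x _ axb]; apply: nsol; exists x.
  (* [a * a] witnesses that [aT] is non-empty: [T] need not have an identity *)
  split; first by exists (a * a), a.
  by move=> _ y [x _ <-]; exists (x * y); rewrite ?mulgA.
- apply/negP; rewrite negbK; apply/eqP/seteqP; split=> // b _.
  by have [x <-] := solT a b; apply: RM.
Qed.

Theorem lemma5 (S : semigroupType) (hS : right_simple S)
  (Lambda : Type) (hLambda : inhabited Lambda) (P : Lambda -> S) :
  right_simple (sandwich P).
Proof.
move/right_simpleP: hS => solS; apply/right_simpleP => -[s l] [u n].
by have [t stu] := solS (s * P l) u; exists (t, n); congr (_, _).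
Qed.
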